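(* Let $N\geq 1$ and let $(h_0,\ldots,h_{N-1})$ be a positive $s$-composable schedule with rate $\eta$. Let $\lambda>0$. For a proper closed convex function $F:\mathbb{R}^d\to\mathbb{R}\cup\{+\infty\}$ with nonempty minimizer set and a starting point $x_0\in\mathbb{R}^d$, run $$z_k=\operatorname{prox}_{\lambda F}(x_k),\qquad x_{k+1}=x_k+h_k(z_k-x_k),\qquad k=0,\ldots,N-1,$$ and set $z_N=\operatorname{prox}_{\lambda F}(x_N)$. Then $$\sup\ \frac{\lambda\bigl(F(z_N)-F_*\bigr)}{\|x_0-x_*\|^2}=\frac{\eta}{4},$$ where $F_*=\min F$ and the supremum is over all dimensions $d\geq1$, all proper closed convex $F:\mathbb{R}^d\to\mathbb{R}\cup\{+\infty\}$ with a nonempty minimizer set, all $x_*\in\arg\min F$, and all $x_0\in\mathbb{R}^d$ with $x_0\neq x_*$.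
   Context: Norms are Euclidean. For proper closed convex $F$ and $\lambda>0$, $\operatorname{prox}_{\lambda F}(x)=\arg\min_z\{F(z)+\frac{1}{2\lambda}\|z-x\|^2\}$. Let $\mathcal{F}_{0,1}$ be the class of differentiable convex functions $f:\mathbb{R}^d\to\mathbb{R}$ (any dimension $d$) whose gradient is $1$-Lipschitz and whose minimizer set is nonempty; write $f_*=\min f$. A schedule $(h_0,\ldots,h_{N-1})$ is positive if all $h_k>0$. Definition ($s$-composability). A positive schedule $(h_0,\ldots,h_{N-1})$ is $s$-composable with rate $\eta$ if $$\eta=\frac{1}{1+\sum_{k=0}^{N-1}h_k}=\prod_{k=0}^{N-1}(h_k-1)$$ and, for every $f\in\mathcal{F}_{0,1}$, every $x_*\in\arg\min f$ and every $x_0$, the iterates $x_{k+1}=x_k-h_k\nabla f(x_k)$, $k=0,\ldots,N-1$, satisfy $$\frac{1-\eta}{2}\|\nabla f(x_N)\|^2+\frac{\eta^2}{2}\|x_N-x_*\|^2+\eta(1-\eta)(f(x_N)-f_* )\leq\frac{\eta^2}{2}\|x_0-x_*\|^2.$$ *)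

(* Defs.v *)
From HB Require Import structures.
From mathcomp Require Import all_boot all_order all_algebra.
From mathcomp Require Import all_classical all_reals all_analysis.
Import Order.TTheory GRing.Theory Num.Theory.
Import numFieldNormedType.Exports.

Set Implicit Arguments.
Unset Strict Implicit.
Unset Printing Implicit Defensive.

Local Open Scope classical_set_scope.
Local Open Scope ring_scope.

(* The library norm [`|x|] on ['rV[R]_d] is the sup norm; it induces the same
   topology and the same notion of differentiability as the norm below. *)
Definition eucl_norm (R : realType) (d : nat) (x : 'rV[R]_d) : R :=
  Num.sqrt (\sum_(i < d) x ord0 i ^+ 2).

Definition argmin (disp : Order.disp_t) (T : Type) (P : porderType disp)
    (f : T -> P) : set T :=
  [set x | forall y, (f x <= f y)%O].

Definition gradient (R : realType) (d : nat) (f : 'rV[R]_d -> R)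
    (x : 'rV[R]_d) : 'rV[R]_d :=
  \row_(i < d) 'D_(delta_mx ord0 i) f x.

(* The class F_{0,1} in dimension d. *)
Definition smooth_convex (R : realType) (d : nat) (f : 'rV[R]_d -> R) : Prop :=
  [/\ forall x, differentiable f x,
      convex_function setT f,
      forall x y,
        eucl_norm (gradient f x - gradient f y) <= eucl_norm (x - y)
    & argmin f !=set0].

Fixpoint gd_iter (R : realType) (d : nat) (f : 'rV[R]_d -> R) (h : seq R)
    (x0 : 'rV[R]_d) (k : nat) : 'rV[R]_d :=
  if k is k'.+1 then
    let x := gd_iter f h x0 k' in x - h`_k' *: gradient f x
  else x0.

Definition positive_schedule (R : realType) (N : nat) (h : N.-tuple R) : Prop :=
  forall k : 'I_N, 0 < h`_k.

Definition s_composable (R : realType) (N : nat) (h : N.-tuple R) (eta : R) :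
    Prop :=
  [/\ positive_schedule h,
      eta = 1 / (1 + \sum_(k < N) h`_k),
      eta = \prod_(k < N) (h`_k - 1)
    & forall (d : nat) (f : 'rV[R]_d -> R), smooth_convex f ->
      forall xs x0 : 'rV[R]_d, argmin f xs ->
      let xN := gd_iter f h x0 N in
      let fmin := inf (range f) in
      (1 - eta) / 2 * eucl_norm (gradient f xN) ^+ 2
        + eta ^+ 2 / 2 * eucl_norm (xN - xs) ^+ 2
        + eta * (1 - eta) * (f xN - fmin)
      <= eta ^+ 2 / 2 * eucl_norm (x0 - xs) ^+ 2].

(* Functions R^d -> R u {+oo} are represented as [\bar R]-valued functions
   that never take the value [-oo]; "closed" means that the epigraph is. *)
Definition proper_closed_convex (R : realType) (d : nat)
    (F : 'rV[R]_d -> \bar R) : Prop :=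
  [/\ forall x, F x != -oo%E,
      exists x, F x != +oo%E,
      closed [set p : 'rV[R]_d * R | (F p.1 <= p.2%:E)%E]
    & forall (x y : 'rV[R]_d) (t : R), 0 <= t <= 1 ->
      (F (t *: x + (1 - t) *: y)%R
        <= t%:E * F x + (1 - t)%:E * F y)%E].

(* For F proper closed convex and 0 < lam the argmin is a singleton, so the
   default value of [xget] is never used. *)
Definition prox (R : realType) (d : nat) (lam : R) (F : 'rV[R]_d -> \bar R)
    (x : 'rV[R]_d) : 'rV[R]_d :=
  xget x (argmin (fun z : 'rV[R]_d =>
    F z + (1 / (2 * lam) * eucl_norm (z - x) ^+ 2)%:E)%E).

Fixpoint prox_iter (R : realType) (d : nat) (lam : R) (F : 'rV[R]_d -> \bar R)
    (h : seq R) (x0 : 'rV[R]_d) (k : nat) : 'rV[R]_d :=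
  if k is k'.+1 then
    let x := prox_iter lam F h x0 k' in x + h`_k' *: (prox lam F x - x)
  else x0.

(* Main.v *)
(* The Moreau envelope M of lam * F lies in F_{0,1}, has the minimizers of F,
   and its gradient is x - prox x, so the relaxed proximal iteration is gradient
   descent on M.  With g = x_N - z_N and u = x_N - x_*, s-composability bounds
   M(x_N) - M_* = lam (F(z_N) - F_* ) + |g|^2 / 2, and g being a subgradient of
   lam * F at z_N gives lam (F(z_N) - F_* ) + |g|^2 <= <g, u>.  Combining these
   with |eta u - (1 + eta) g|^2 >= 0 yields the upper bound.
   It is attained by F(z) = eta / (2 lam) |z| on the line, started at 1: all
   iterates stay where the prox is the translation by -eta / 2, so that
   z_N = 1 - (eta / 2) (1 + sum_k h_k) = 1 / 2. *)
Require Import Defs.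
From HB Require Import structures.
From mathcomp Require Import all_boot all_order all_algebra ring lra.
From mathcomp Require Import all_classical all_reals all_analysis.
Import Order.TTheory GRing.Theory Num.Theory.
Import numFieldNormedType.Exports.

Set Implicit Arguments.
Unset Strict Implicit.
Unset Printing Implicit Defensive.

Local Open Scope classical_set_scope.
Local Open Scope ring_scope.

(** * Euclidean inner product and its comparison with the sup norm *)

Definition dot (R : realType) (d : nat) (x y : 'rV[R]_d) : R :=
  (x *m y^T) ord0 ord0.

Lemma dotE (R : realType) (d : nat) (x y : 'rV[R]_d) :
  dot x y = \sum_(i < d) x ord0 i * y ord0 i.
Proof. by rewrite /dot mxE; apply: eq_bigr => i _; rewrite mxE. Qed.

Lemma dotC (R : realType) (d : nat) (x y : 'rV[R]_d) : dot x y = dot y x.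
Proof. by rewrite !dotE; apply: eq_bigr => i _; rewrite mulrC. Qed.

Lemma dot_is_linear (R : realType) (d : nat) (v : 'rV[R]_d) :
  linear (dot v).
Proof.
by move=> a x y; rewrite /dot linearP /= mulmxDr -scalemxAr !mxE.
Qed.

(** The linear structure makes [dot v] a candidate differential for [diff_unique]. *)
HB.instance Definition _ (R : realType) (d : nat) (v : 'rV[R]_d) :=
  GRing.isLinear.Build R 'rV[R]_d R *:%R (dot v) (dot_is_linear v).

Lemma dotDr (R : realType) (d : nat) (x y z : 'rV[R]_d) :
  dot x (y + z) = dot x y + dot x z.
Proof. exact: linearD. Qed.

Lemma dotNr (R : realType) (d : nat) (x y : 'rV[R]_d) : dot x (- y) = - dot x y.
Proof. exact: linearN. Qed.

Lemma dotZr (R : realType) (d : nat) (a : R) (x y : 'rV[R]_d) :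
  dot x (a *: y) = a * dot x y.
Proof. exact: linearZ. Qed.

Lemma dotDl (R : realType) (d : nat) (x y z : 'rV[R]_d) :
  dot (y + z) x = dot y x + dot z x.
Proof. by rewrite !(dotC _ x) dotDr. Qed.

Lemma dotNl (R : realType) (d : nat) (x y : 'rV[R]_d) : dot (- y) x = - dot y x.
Proof. by rewrite !(dotC _ x) dotNr. Qed.

Lemma dotZl (R : realType) (d : nat) (a : R) (x y : 'rV[R]_d) :
  dot (a *: y) x = a * dot y x.
Proof. by rewrite !(dotC _ x) dotZr. Qed.

Definition dot_bilin := (dotDl, dotDr, dotNl, dotNr, dotZl, dotZr).

Lemma dotxx_ge0 (R : realType) (d : nat) (x : 'rV[R]_d) : 0 <= dot x x.
Proof. by rewrite dotE sumr_ge0 // => i _; rewrite -expr2 sqr_ge0. Qed.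

Lemma dot_delta (R : realType) (d : nat) (x : 'rV[R]_d) (i : 'I_d) :
  dot x (delta_mx ord0 i) = x ord0 i.
Proof.
rewrite dotE (bigD1 i) //= mxE !eqxx mulr1 big1 ?addr0 // => j /negPf ji.
by rewrite mxE ji mulr0.
Qed.

Lemma eucl_norm_sqr (R : realType) (d : nat) (x : 'rV[R]_d) :
  eucl_norm x ^+ 2 = dot x x.
Proof.
rewrite /eucl_norm sqr_sqrtr ?sumr_ge0 // => [|i _]; last exact: sqr_ge0.
by rewrite dotE; apply: eq_bigr => i _; rewrite expr2.
Qed.

Lemma eucl_norm_le (R : realType) (d : nat) (x y : 'rV[R]_d) :
  (eucl_norm x <= eucl_norm y) = (dot x x <= dot y y).
Proof. by rewrite -!eucl_norm_sqr ler_sqr // nnegrE sqrtr_ge0. Qed.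

Lemma coord_le_norm (R : realType) (d : nat) (x : 'rV[R]_d) (i : 'I_d) :
  `|x ord0 i| <= `|x|.
Proof.
rewrite [leRHS]/Num.norm /= mx_normrE.
exact: (le_bigmax _ (fun ij : 'I_1 * 'I_d => `|x ij.1 ij.2|) (ord0, i)).
Qed.

Lemma dotxx_le_norm (R : realType) (d : nat) (x : 'rV[R]_d) :
  dot x x <= d%:R * `|x| ^+ 2.
Proof.
rewrite dotE mulrC mulr_natr -[X in _ *+ X]card_ord -sumr_const.
apply: ler_sum => i _.
by rewrite -expr2 -real_normK ?num_real // ler_sqr ?nnegrE // coord_le_norm.
Qed.

Lemma dot_continuous (R : realType) (d : nat) (v : 'rV[R]_d) :
  continuous (dot v).
Proof.
rewrite (_ : dot v = fun x => \sum_(i < d) v ord0 i * x ord0 i); last first.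
  by apply/funext => x; exact: dotE.
apply: continuous_big => [|i _ x]; first exact: add_continuous.
by apply: continuousM; [exact: cst_continuous|exact: coord_continuous].
Qed.

Lemma dotxx_continuous (R : realType) (d : nat) :
  continuous (fun x : 'rV[R]_d => dot x x).
Proof.
rewrite (_ : (fun _ => _) = fun x : 'rV[R]_d =>
  \sum_(i < d) x ord0 i * x ord0 i); last first.
  by apply/funext => x; exact: dotE.
apply: continuous_big => [|i _ x]; first exact: add_continuous.
by apply: continuousM; exact: coord_continuous.
Qed.

Lemma diff_quadratic_bound (R : realType) (d : nat) (f : 'rV[R]_d -> R)
    (x v : 'rV[R]_d) :
  (forall y, `|f y - f x - dot v (y - x)| <= dot (y - x) (y - x)) ->
  differentiable f x /\ 'd f x = dot v :> ('rV[R]_d -> R).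
Proof.
move=> fv.
have exp : f \o shift x = cst (f x) + dot v +o_ (0 : 'rV[R]_d) id.
  apply/eqaddoP => e e0; near=> y.
  rewrite !fctE /=.
  have := fv (y + x); rewrite addrK opprD addrA => /le_trans; apply.
  apply: le_trans (dotxx_le_norm _) _.
  rewrite expr2 mulrA; apply: ler_wpM2r => //.
  (* The little-o is measured in the sup norm, hence the factor [d]. It is raised to [d.+1] so that
     the radius [e / d.+1] makes sense in dimension 0. *)
  suff : d.+1%:R * `|y| <= e.
    by apply: le_trans; apply: ler_wpM2r => //; rewrite ler_nat.
  rewrite mulrC -ler_pdivlMr ?ltr0n //.
  near: y; apply: (@nbhs0_le _ 'rV[R]_d); rewrite divr_gt0 // ltr0n.
have dE := diff_unique (@dot_continuous R d v) exp.
split=> //; apply/diff_locallyP; rewrite dE; split => //.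
exact: dot_continuous.
Unshelve. all: by end_near. Qed.

(** The two bounds squeeze f y - f x - <g x, y - x> between 0 and |y - x|^2 / 2, so f is
    differentiable with gradient g. Convexity weighs the lower bounds based at the intermediate
    point. Adding the lower bounds for (x, y) and (y, x) gives |g x - g y|^2 <= <g x - g y, x - y>;
    expanding |(x - y) - (g x - g y)|^2 >= 0 then gives the Lipschitz bound without
    Cauchy-Schwarz. *)
Lemma cocoercive_smooth_convex (R : realType) (d : nat) (f : 'rV[R]_d -> R)
    (g : 'rV[R]_d -> 'rV[R]_d) :
  (forall x y, f x + dot (g x) (y - x) + dot (g y - g x) (g y - g x) / 2
     <= f y) ->
  (forall x y, f y <= f x + dot (g x) (y - x) + dot (y - x) (y - x) / 2) ->
  argmin f !=set0 ->
  smooth_convex f /\ gradient f = g.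
Proof.
move=> lo up fmin.
have df x : differentiable f x /\ 'd f x = dot (g x) :> ('rV[R]_d -> R).
  apply: diff_quadratic_bound => y.
  have := lo x y; have := up x y.
  have := dotxx_ge0 (y - x); have := dotxx_ge0 (g y - g x).
  by rewrite ler_norml => *; apply/andP; split; lra.
have gE : gradient f = g.
  apply/funext => x; apply/rowP => i; rewrite mxE deriveE; last by case: (df x).
  by case: (df x) => _ ->; rewrite dot_delta.
split => //; split => //; first by move=> x; case: (df x).
- move=> t x y _ _; pose s := t%:num : R.
  suff : f (s *: x + (1 - s) *: y) <= s * f x + (1 - s) * f y by [].
  have s0 : 0 <= s by rewrite /s ge0.
  have s1 : s <= 1 by rewrite /s le1.
  have := lo (s *: x + (1 - s) *: y) x; have := lo (s *: x + (1 - s) *: y) y.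
  set w := s *: x + _.
  have := dotxx_ge0 (g x - g w); have := dotxx_ge0 (g y - g w).
  set a := dot (_ - _) _; set b := dot (_ - _) _ => a0 b0.
  have -> : y - w = s *: (y - x) by apply/rowP => i; rewrite !mxE; ring.
  have -> : x - w = - (1 - s) *: (y - x) by apply/rowP => i; rewrite !mxE; ring.
  rewrite !dotZr; set c := dot _ _.
  nra.
- move=> x y; rewrite gE eucl_norm_le.
  have := lo x y; have := lo y x.
  have := dotxx_ge0 ((x - y) - (g x - g y)).
  rewrite !dot_bilin (dotC (g y)) (dotC y) (dotC x (g x)) (dotC x (g y)).
  rewrite (dotC y (g x)) (dotC y (g y)); lra.
Qed.

(** * Existence of the proximal point and its subgradient inequality *)

Lemma argmin_fin_num (R : realType) (d : nat) (F : 'rV[R]_d -> \bar R)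
    (xs : 'rV[R]_d) :
  proper_closed_convex F -> argmin F xs -> F xs \is a fin_num.
Proof.
move=> [FN [x Fx] _ _] Fxs.
by rewrite fin_numE FN -ltey; apply: (le_lt_trans (Fxs x)); rewrite ltey.
Qed.

(** [F] itself need not be continuous, but on its epigraph the prox objective becomes t + c |z -
    x|^2, which is continuous in (z, t). Minimization therefore takes place there. *)
Lemma prox_objective_continuous_closed (R : realType) (d : nat)
    (F : 'rV[R]_d -> \bar R)
    (x : 'rV[R]_d) (c C : R) :
  closed [set p : 'rV[R]_d * R | (F p.1 <= p.2%:E)%E] ->
  continuous (fun p : 'rV[R]_d * R => p.2 + c * dot (p.1 - x) (p.1 - x)) /\
  closed [set p : 'rV[R]_d * R |
    (F p.1 <= p.2%:E)%E /\ p.2 + c * dot (p.1 - x) (p.1 - x) <= C].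
Proof.
move=> clF.
have cont : continuous
    (fun p : 'rV[R]_d * R => p.2 + c * dot (p.1 - x) (p.1 - x)).
  move=> p; apply: continuousD; first exact: cvg_snd.
  apply: continuousM; first exact: cst_continuous.
  apply: (@continuous_comp _ _ _ (fun p : 'rV[R]_d * R => p.1 - x)
    (fun z => dot z z)); last exact: dotxx_continuous.
  by apply: continuousB; [exact: cvg_fst|exact: cst_continuous].
split=> //; apply: closedI => //.
apply: (@preimage_closed _ _ _ [set t | t <= C]); last exact: closed_le.
by move=> p _; exact: cont.
Qed.

Lemma prox_argmin (R : realType) (d : nat) (lam : R) (F : 'rV[R]_d -> \bar R)
    (xs x : 'rV[R]_d) :
  0 < lam -> proper_closed_convex F -> argmin F xs ->
  argmin (fun z : 'rV[R]_d =>
    F z + (1 / (2 * lam) * eucl_norm (z - x) ^+ 2)%:E)%E (prox lam F x).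
Proof.
move=> lam0 pF Fxs; apply: (@xgetPex _ x (argmin _)).
have Ffin := argmin_fin_num pF Fxs.
case: pF => [FN _ clF _].
set c := 1 / _; have c0 : 0 < c by rewrite divr_gt0 // mulr_gt0.
pose m := fine (F xs); pose C := m + c * dot (xs - x) (xs - x).
have mE : F xs = m%:E by rewrite fineK.
have [cont clK] := prox_objective_continuous_closed x c C clF.
set K := [set p | _] in clK.
have Kxs : K (xs, m) by rewrite /K /= mE lexx.
(* On [K], t >= m forces (z_i - x_i)^2 <= (C - m) / c, and |s| <= 1 + s^2 turns this into a box of
   half-width [r] without a square root. *)
pose r := 1 + (C - m) / c.
have Kcompact : compact K.
  apply: (subclosed_compact clK (compact_setX
    (rV_compact (fun i => @segment_compact R (x ord0 i - r) (x ord0 i + r)))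
    (@segment_compact R m C))).
  move=> [z t] [/= Fzt ztC].
  have mt : m <= t by rewrite -lee_fin -mE; apply: le_trans Fzt.
  have d0 := dotxx_ge0 (z - x).
  split; last first.
    by rewrite /= in_itv /= mt /=; have := mulr_ge0 (ltW c0) d0; lra.
  move=> i /=; rewrite in_itv /=.
  have dle : dot (z - x) (z - x) <= (C - m) / c.
    by rewrite ler_pdivlMr // mulrC; lra.
  have ile : (z ord0 i - x ord0 i) ^+ 2 <= dot (z - x) (z - x).
    rewrite dotE (bigD1 i) //= !mxE -expr2 lerDl sumr_ge0 // => j _.
    by rewrite -expr2 sqr_ge0.
  by rewrite /r; apply/andP; split; nra.
have [|[p t] /set_mem[/= Fpt ptC] pmin] := compact_EVT_min _ Kcompact
  (continuous_subspaceT cont); first by exists (xs, m).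
exists p => z; rewrite !eucl_norm_sqr.
apply: (@le_trans _ _ (t + c * dot (p - x) (p - x))%:E).
  by rewrite EFinD leeD2r.
case Fz : (F z) => [w| |]; last 2 first.
- by rewrite addye // leey.
- by have := FN z; rewrite Fz eqxx.
rewrite -EFinD lee_fin.
(* A point whose objective exceeds [C] lies outside [K], but the minimum over [K] is at most [C]. *)
have [zC|zC] := leP (w + c * dot (z - x) (z - x)) C.
  by apply: (pmin (z, w)); rewrite inE /K /= Fz lexx.
exact: le_trans ptC (ltW zC).
Qed.

Lemma le0_small (R : realType) (a b : R) :
  (forall t, 0 < t <= 1 -> a <= t * b) -> a <= 0.
Proof.
move=> ab; rewrite leNgt; apply/negP => a0.
have := ab 1; rewrite ltr01 lexx mul1r => /(_ isT) leab.
have b0 : 0 < b by exact: lt_le_trans leab.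
(* The case t = 1 gave a <= b, so t = a / (2 b) is at most 1/2 and yields a <= a / 2. *)
have : a <= a / (2 * b) * b.
  apply: ab; rewrite divr_gt0 ?mulr_gt0 //= ler_pdivrMr ?mulr_gt0 //; lra.
by rewrite invfM mulrA divfK ?gt_eqF //; lra.
Qed.

Lemma prox_fin_num (R : realType) (d : nat) (lam : R) (F : 'rV[R]_d -> \bar R)
    (xs x : 'rV[R]_d) :
  0 < lam -> proper_closed_convex F -> argmin F xs ->
  F (prox lam F x) \is a fin_num.
Proof.
move=> lam0 pF Fxs; have Ffin := argmin_fin_num pF Fxs.
have := prox_argmin x lam0 pF Fxs xs; rewrite /= -(fineK Ffin) -EFinD.
case: pF => [FN _ _ _]; move: (FN (prox lam F x)).
by case: (F _).
Qed.

(** Compare the minimizer p with t y + (1 - t) p, apply convexity and divide by t: the inequality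
    holds up to an error t |y - p|^2 / 2, which [le0_small] removes. *)
Lemma prox_subgradient (R : realType) (d : nat) (lam : R)
    (F : 'rV[R]_d -> \bar R) (xs x y : 'rV[R]_d) :
  0 < lam -> proper_closed_convex F -> argmin F xs -> F y \is a fin_num ->
  lam * fine (F (prox lam F x)) + dot (x - prox lam F x) (y - prox lam F x)
    <= lam * fine (F y).
Proof.
move=> lam0 pF Fxs Fy.
have pmin := prox_argmin x lam0 pF Fxs; have Fp := prox_fin_num x lam0 pF Fxs.
move: pmin Fp; set p := prox lam F x => pmin Fp.
case: pF => [FN _ _ cvxF].
rewrite -subr_le0; apply: (@le0_small _ _ (dot (y - p) (y - p) / 2)).
move=> t /andP[t0 t1].
have := cvxF y p t; rewrite (ltW t0) t1 => /(_ isT).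
have := pmin (t *: y + (1 - t) *: p).
have := FN (t *: y + (1 - t) *: p).
rewrite /= !eucl_norm_sqr.
have -> : t *: y + (1 - t) *: p - x = t *: (y - p) - (x - p).
  by apply/rowP => i; rewrite !mxE; ring.
have -> : p - x = - (x - p) by rewrite opprB.
rewrite -(fineK Fp) -(fineK Fy) -!EFinM.
case: (F (_ + _)) => [w _| |//]; last by rewrite leye_eq.
rewrite -!EFinD !lee_fin /= !dot_bilin (dotC y p) (dotC x p) (dotC y x).
set a := fine (F p); set b := fine (F y).
set c := 1 / _; have clam : lam * c = 2^-1.
  by rewrite /c div1r invfM mulrCA mulfV ?mulr1 // gt_eqF.
move: c clam => c clam.
move=> /(ler_wpM2l (ltW lam0)) + /(ler_wpM2l (ltW lam0)).
rewrite !(mulrDr lam) !(mulrA lam c) clam => h1 h2.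
rewrite -(ler_pM2l t0); lra.
Qed.

(** * The algebraic inequalities behind the upper bound *)

Lemma moreau_bounds (R : realType) (d : nat) (phi : 'rV[R]_d -> R)
    (P : 'rV[R]_d -> 'rV[R]_d) (M := fun x : 'rV[R]_d =>
      phi (P x) + dot (x - P x) (x - P x) / 2)
    (g := fun x : 'rV[R]_d => x - P x) :
  (forall x y, phi (P x) + dot (x - P x) (P y - P x) <= phi (P y)) ->
  (forall x y, M x + dot (g x) (y - x) + dot (g y - g x) (g y - g x) / 2
     <= M y) /\
  (forall x y, M y <= M x + dot (g x) (y - x) + dot (y - x) (y - x) / 2).
Proof.
move=> sub; split=> x y; rewrite /M /g.
(* The slack of the lower bound equals the slack of [sub x y]; that of the upper bound equals the
   slack of [sub y x] plus |P y - P x|^2 / 2. *)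
- have := sub x y.
  rewrite !dot_bilin (dotC y x) ?(dotC (P _) x) ?(dotC (P _) y).
  rewrite (dotC (P y) (P x)); lra.
- have := sub y x; have := dotxx_ge0 (P y - P x).
  rewrite !dot_bilin (dotC y x) ?(dotC (P _) x) ?(dotC (P _) y).
  rewrite (dotC (P y) (P x)); lra.
Qed.

(** The left side of the last hypothesis minus 2 eta Delta is exactly |eta u - (1 + eta) g|^2 / 2
    plus eta (1 + eta) times the slack of Delta + |g|^2 <= <g, u>. *)
Lemma rate_bound (R : realType) (d : nat) (g u : 'rV[R]_d) (eta D Delta : R) :
  0 < eta -> Delta + dot g g <= dot g u ->
  (1 - eta) / 2 * dot g g + eta ^+ 2 / 2 * dot u u
    + eta * (1 - eta) * (Delta + dot g g / 2) <= eta ^+ 2 / 2 * D ->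
  Delta <= eta / 4 * D.
Proof.
move=> eta0 gu.
have := dotxx_ge0 (eta *: u - (1 + eta) *: g); rewrite !dot_bilin (dotC u g).
have : 0 <= eta * (1 + eta) * (dot g u - (Delta + dot g g)).
  by apply: mulr_ge0; [nra|lra].
move=> h1 h2 h3; rewrite -(ler_pM2l eta0); lra.
Qed.

(** * The Moreau envelope and the upper bound *)

Lemma inf_range_argmin (R : realType) (T : Type) (f : T -> R) (x : T) :
  argmin f x -> inf (range f) = f x.
Proof.
move=> fx; have lb : lbound (range f) (f x) by move=> _ [y _ <-]; exact: fx.
apply/eqP; rewrite eq_le; apply/andP; split.
  by apply: ge_inf; [exists (f x)|exists x].
by apply: lb_le_inf; [exists (f x), x|].
Qed.

Lemma ereal_inf_range_argmin (R : realType) (T : Type) (f : T -> \bar R)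
    (x : T) :
  argmin f x -> ereal_inf (range f) = f x.
Proof.
move=> fx; apply/eqP; rewrite eq_le; apply/andP; split.
  by apply: ereal_inf_lbound; exists x.
by apply: le_ereal_inf_tmp => _ [y _ <-]; exact: fx.
Qed.

(** This is [lam] times the usual envelope of [F] with parameter [lam], a scaling that makes the
    gradient 1-Lipschitz. By [prox_fin_num], [fine] loses nothing when [F] is proper closed convex
    with a minimizer. *)
Definition moreau (R : realType) (d : nat) (lam : R) (F : 'rV[R]_d -> \bar R)
    (x : 'rV[R]_d) : R :=
  lam * fine (F (prox lam F x))
    + dot (x - prox lam F x) (x - prox lam F x) / 2.

Lemma moreau_argmin (R : realType) (d : nat) (lam : R)
    (F : 'rV[R]_d -> \bar R) (xs : 'rV[R]_d) :
  0 < lam -> proper_closed_convex F -> argmin F xs ->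
  argmin (moreau lam F) xs /\ moreau lam F xs = lam * fine (F xs).
Proof.
move=> lam0 pF Fxs; have Ffin := argmin_fin_num pF Fxs.
have lb y : lam * fine (F xs) <= moreau lam F y.
  have : lam * fine (F xs) <= lam * fine (F (prox lam F y)).
    rewrite ler_pM2l //; apply: fine_le => //.
    exact: prox_fin_num lam0 pF Fxs.
  by rewrite /moreau; have := dotxx_ge0 (y - prox lam F y); lra.
have ME : moreau lam F xs = lam * fine (F xs).
  apply/eqP; rewrite eq_le lb andbT /moreau.
  (* Tested at [xs] itself, with p the prox of [xs], this reads lam F(p) + |xs - p|^2 <= lam F(xs),
     so p = [xs] need not be proved first. *)
  have := prox_subgradient xs lam0 pF Fxs Ffin.
  have := dotxx_ge0 (xs - prox lam F xs); lra.
by split; [rewrite /argmin /= => y; rewrite ME; exact: lb|exact: ME].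
Qed.

Lemma moreau_smooth_convex (R : realType) (d : nat) (lam : R)
    (F : 'rV[R]_d -> \bar R) (xs : 'rV[R]_d) :
  0 < lam -> proper_closed_convex F -> argmin F xs ->
  smooth_convex (moreau lam F) /\
  gradient (moreau lam F) = fun x => x - prox lam F x.
Proof.
move=> lam0 pF Fxs.
have [lo up] := @moreau_bounds R d (fun z => lam * fine (F z)) (prox lam F)
  (fun x y => prox_subgradient x lam0 pF Fxs (prox_fin_num y lam0 pF Fxs)).
apply: cocoercive_smooth_convex lo up _.
by exists xs; case: (moreau_argmin lam0 pF Fxs).
Qed.

Lemma gd_iter_moreau (R : realType) (d : nat) (lam : R)
    (F : 'rV[R]_d -> \bar R) (xs x0 : 'rV[R]_d) (h : seq R) (k : nat) :
  0 < lam -> proper_closed_convex F -> argmin F xs ->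
  gd_iter (moreau lam F) h x0 k = prox_iter lam F h x0 k.
Proof.
move=> lam0 pF Fxs; elim: k => //= k ->.
have [_ ->] := moreau_smooth_convex lam0 pF Fxs.
by rewrite -scalerN opprB.
Qed.

Lemma prox_iter_upper (R : realType) (N : nat) (h : N.-tuple R) (eta lam : R)
    (d : nat) (F : 'rV[R]_d -> \bar R) (xs x0 : 'rV[R]_d) :
  s_composable h eta -> 0 < eta -> 0 < lam -> proper_closed_convex F ->
  argmin F xs ->
  lam * (fine (F (prox lam F (prox_iter lam F h x0 N))) - fine (F xs))
    <= eta / 4 * dot (x0 - xs) (x0 - xs).
Proof.
move=> [_ _ _ comp] eta0 lam0 pF Fxs.
have [Msc Mgrad] := moreau_smooth_convex lam0 pF Fxs.
have [Mmin ME] := moreau_argmin lam0 pF Fxs.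
have := comp d _ Msc xs x0 Mmin.
rewrite /= (gd_iter_moreau _ _ _ lam0 pF Fxs) Mgrad !eucl_norm_sqr.
rewrite (inf_range_argmin Mmin) ME.
set x := prox_iter _ _ _ _ _; rewrite /moreau; set z := prox lam F x => h1.
apply: (@rate_bound _ _ (x - z) (x - xs)) => //.
  (* With g = x - z and u = x - xs, testing at [xs] uses xs - z = g - u, which produces the term
     |g|^2 - <g, u>. *)
  have := prox_subgradient x lam0 pF Fxs (argmin_fin_num pF Fxs); rewrite -/z.
  have -> : xs - z = (x - z) - (x - xs) by apply/rowP => i; rewrite !mxE; ring.
  rewrite dotDr dotNr; lra.
move: h1; lra.
Qed.

(** * The extremal function on the line *)

Definition scaled_abs (R : realType) (c : R) (z : 'rV[R]_1) : \bar R :=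
  (c * `|z ord0 ord0|)%:E.

Lemma scaled_abs_pcc (R : realType) (c : R) :
  0 <= c -> proper_closed_convex (scaled_abs c).
Proof.
move=> c0; split.
- by [].
- by exists 0.
- rewrite (_ : [set _ | _] = (fun p : 'rV[R]_1 * R =>
      p.2 - c * `|p.1 ord0 ord0|) @^-1` [set t | 0 <= t]).
    apply: preimage_closed; last exact: closed_ge.
    move=> p _; apply: continuousB; first exact: cvg_snd.
    apply: continuousM; first exact: cst_continuous.
    apply: (@continuous_comp _ _ _ (fun p : 'rV[R]_1 * R => p.1 ord0 ord0)
      (fun t : R => `|t|)); last exact: norm_continuous.
    apply: (@continuous_comp _ _ _ (fun p : 'rV[R]_1 * R => p.1)
      (fun t : 'rV[R]_1 => t ord0 ord0)); first exact: cvg_fst.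
    exact: coord_continuous.
  by apply/seteqP; split=> p; rewrite /preimage /= /scaled_abs lee_fin subr_ge0.
- move=> x y t /andP[t0 t1].
  rewrite /scaled_abs -!EFinM -EFinD lee_fin !mxE.
  rewrite [X in _ <= X + _]mulrCA [X in _ <= _ + X]mulrCA -mulrDr ler_wpM2l //.
  apply: le_trans (ler_normD _ _) _.
  by rewrite !normrM (ger0_norm t0) (@ger0_norm _ (1 - t)) ?subr_ge0.
Qed.

Lemma prox_scaled_abs (R : realType) (lam c : R) (x : R) :
  0 < lam -> 0 <= c -> lam * c <= x ->
  prox lam (scaled_abs c) (const_mx x) = const_mx (x - lam * c).
Proof.
move=> lam0 c0 cx.
set p := const_mx (x - _).
pose q (z : 'rV[R]_1) := dot (z - const_mx x) (z - const_mx x).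
(* Quadratic growth around [p] gives both minimality and the uniqueness that [xget_unique] demands.
   After |z| >= z it is an identity. *)
have key (z : 'rV[R]_1) :
    lam * c * `|p ord0 ord0| + q p / 2 + (z ord0 ord0 - p ord0 ord0) ^+ 2 / 2
    <= lam * c * `|z ord0 ord0| + q z / 2.
  rewrite /q !dotE !big_ord1 !mxE (@ger0_norm _ (x - _)); last lra.
  have := ler_norm (z ord0 ord0).
  have : 0 <= lam * c by rewrite mulr_ge0 // ltW.
  set t := lam * c in cx *; nra.
have objE (z : 'rV[R]_1) : lam * c * `|z ord0 ord0| + q z / 2
    = lam * (c * `|z ord0 ord0| + 1 / (2 * lam) * q z).
  by field; rewrite gt_eqF.
apply: xget_unique => [z|z /(_ p)];
  rewrite /= /scaled_abs -!EFinD lee_fin !eucl_norm_sqr -!/(q _);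
  rewrite -(ler_pM2l lam0) -!objE.
  by have := key z; have := sqr_ge0 (z ord0 ord0 - p ord0 ord0); lra.
have := key z => h1 h2.
have : (z ord0 ord0 - p ord0 ord0) ^+ 2 <= 0 by lra.
rewrite real_exprn_even_le0 ?num_real //= subr_eq0 => /eqP zp.
by apply/rowP => i; rewrite (ord1 i).
Qed.

(** The summand 1 in the hypothesis keeps every iterate up to step [k] at or above the threshold
    [lam * c], so step i moves by -[lam * c * h_i]. *)
Lemma prox_iter_scaled_abs (R : realType) (lam c : R) (h : seq R) (k : nat) :
  0 < lam -> 0 <= c -> (forall i, (i < k)%N -> 0 <= h`_i) ->
  lam * c * (1 + \sum_(i < k) h`_i) <= 1 ->
  prox_iter lam (scaled_abs c) h (const_mx 1) k =
    const_mx (1 - lam * c * \sum_(i < k) h`_i).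
Proof.
move=> lam0 c0; elim: k => [|k IHk] hpos; first by rewrite big_ord0 mulr0 subr0.
rewrite big_ord_recr /= => hsum.
have hk : 0 <= h`_k by apply: hpos.
have lc0 : 0 <= lam * c by rewrite mulr_ge0 // ltW.
have hk' := mulr_ge0 lc0 hk.
rewrite IHk; last 2 first.
- by move=> i ik; apply: hpos; apply: ltnW.
- lra.
rewrite prox_scaled_abs //; last lra.
by apply/rowP => i; rewrite !mxE; ring.
Qed.

Theorem theorem1 (R : realType) (N : nat) (h : N.-tuple R) (eta lam : R)
    (N_ge1 : (1 <= N)%N) (h_comp : s_composable h eta) (lam_gt0 : 0 < lam) :
  ereal_sup [set v : \bar R |
    exists (d : nat) (F : 'rV[R]_d -> \bar R) (xs x0 : 'rV[R]_d),
      [/\ (1 <= d)%N, proper_closed_convex F, argmin F xs, x0 != xs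
        & let zN := prox lam F (prox_iter lam F h x0 N) in
          let Fmin := ereal_inf (range F) in
          v = (lam%:E * (F zN - Fmin)
                 * ((eucl_norm (x0 - xs) ^+ 2)^-1)%:E)%E]]
  = (eta / 4)%:E.
Proof.
have [hpos etaE _ _] := h_comp.
have sum_ge0 : 0 <= \sum_(k < N) h`_k.
  by apply: sumr_ge0 => k _; rewrite ltW // hpos.
have eta0 : 0 < eta by rewrite etaE divr_gt0 //; lra.
have etaS : eta * (1 + \sum_(k < N) h`_k) = 1.
  by rewrite etaE div1r mulVf // gt_eqF //; lra.
apply/eqP; rewrite eq_le; apply/andP; split.
  apply: ge_ereal_sup => _ [d [F [xs [x0 [_ pF Fxs x0xs ->]]]]] /=.
  have Fz := prox_fin_num (prox_iter lam F h x0 N) lam_gt0 pF Fxs.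
  rewrite (ereal_inf_range_argmin Fxs) -(fineK Fz).
  rewrite -(fineK (argmin_fin_num pF Fxs)) -EFinB -!EFinM lee_fin.
  rewrite eucl_norm_sqr ler_pdivrMr; first exact: prox_iter_upper.
  rewrite lt_neqAle dotxx_ge0 andbT eq_sym.
  apply: contraNneq x0xs => /eqP; rewrite dotE psumr_eq0 => [/allP dx|i _].
    apply/eqP/rowP => i; apply/eqP; rewrite -subr_eq0.
    by have := dx i (mem_index_enum i); rewrite !mxE mulf_eq0 orbb.
  by rewrite -expr2 sqr_ge0.
(* In the translation regime with t = [lam * c], the ratio is t (1 - t (1 + sum h)) = t (1 - t /
   eta), which is largest at t = eta / 2, with value eta / 4. *)
pose c := eta / (2 * lam).
have c0 : 0 <= c by rewrite divr_ge0 ?ltW // mulr_gt0.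
have lamc : lam * c = eta / 2 by rewrite /c; field; rewrite gt_eqF.
have abs_min : argmin (scaled_abs c) 0.
  by move=> y; rewrite /scaled_abs lee_fin !mxE normr0 mulr0 mulr_ge0.
apply: ereal_sup_ubound; exists 1%N, (scaled_abs c), 0, (const_mx 1).
split => //.
- exact: scaled_abs_pcc.
- by apply/eqP => /rowP /(_ ord0); rewrite !mxE; apply/eqP; rewrite oner_eq0.
- rewrite /= prox_iter_scaled_abs //; last 2 first.
  + by move=> i iN; have := hpos (Ordinal iN) => /ltW.
  + by rewrite lamc; lra.
  rewrite prox_scaled_abs //; last by rewrite lamc; lra.
  rewrite (ereal_inf_range_argmin abs_min) /scaled_abs.
  rewrite -EFinB -!EFinM eucl_norm_sqr dotE big_ord1 !mxE ger0_norm; last first.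
    by rewrite lamc; lra.
  congr EFin; rewrite normr0 mulr0 !subr0 mulrA lamc mulr1 invr1 mulr1.
  (* Multiplied by [eta], [etaS] replaces the quadratic term eta^2 (1 + sum h) by eta, leaving a
     linear goal. *)
  have := congr1 ( *%R eta) etaS; lra.
Qed.
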